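(* Let $\boldsymbol{Z}=(Z_1,\dots,Z_d)$ be a generator of a $D$-norm $\|\cdot\|_D$ on $\mathbb{R}^d$, and let $U$ be a random variable which is uniformly distributed on $(0,1)$ and independent of $\boldsymbol{Z}$. Suppose that $E(Z_i^2)<\infty$ and that the distribution function of $Z_i$ is continuous, $1\le i\le d$. Then the copula $C_{\boldsymbol{V}}$ of $$\boldsymbol{V}:=\frac1U\boldsymbol{Z}=\frac1U(Z_1,\dots,Z_d)$$ is in the $\delta$-neighborhood of the generalized Pareto copula $C_D$ with $D$-norm $\|\cdot\|_D$, with $\delta=1$.
   Context: A norm $\|\cdot\|_D$ on $\mathbb{R}^d$ is called a $D$-norm if there exists a random vector $\boldsymbol{Z}=(Z_1,\dots,Z_d)$, called a generator of $\|\cdot\|_D$ (one says that $\boldsymbol{Z}$ generates $\|\cdot\|_D$), with $Z_i\ge 0$ and $E(Z_i)=1$ for $1\le i\le d$, such that $$\|\boldsymbol{x}\|_D=E\left(\max_{1\le i\le d}\left(|x_i|Z_i\right)\right),\qquad \boldsymbol{x}=(x_1,\dots,x_d)\in\mathbb{R}^d .$$ A copula on $\mathbb{R}^d$ is the distribution function (on all of $\mathbb{R}^d$) of a random vector each of whose components is uniformly distributed on $(0,1)$. The copula of a random vector $\boldsymbol{V}=(V_1,\dots,V_d)$ with continuous marginal distribution functions $F_1,\dots,F_d$ is the distribution function of $(F_1(V_1),\dots,F_d(V_d))$. A generalized Pareto copula (GPC) $C_D$ with $D$-norm $\|\cdot\|_D$ is a copula on $\mathbb{R}^d$ for which there is a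 vector $\boldsymbol{u}_0$ with $\boldsymbol{0}<\boldsymbol{u}_0<\boldsymbol{1}=(1,\dots,1)$ (componentwise) such that $C_D(\boldsymbol{u})=1-\|\boldsymbol{1}-\boldsymbol{u}\|_D$ for all $\boldsymbol{u}$ with $\boldsymbol{u}_0\le\boldsymbol{u}\le\boldsymbol{1}$. Let $R:=\{\boldsymbol{t}\in[0,1]^d:\ \sum_{i=1}^d t_i=1\}$. For a copula $C$ on $\mathbb{R}^d$ and $\boldsymbol{t}\in R$ put $C_{\boldsymbol{t}}(s):=C(\boldsymbol{1}+s\boldsymbol{t})$, $s\le 0$; for $C=C_D$ write $C_{D,\boldsymbol{t}}$. For $\delta>0$, the copula $C$ is said to be in the $\delta$-neighborhood of the GPC $C_D$ with $D$-norm $\|\cdot\|_D$ if $$1-C_{\boldsymbol{t}}(s)=\left(1-C_{D,\boldsymbol{t}}(s)\right)\left(1+O\left(|s|^\delta\right)\right)=|s|\,\|\boldsymbol{t}\|_D\left(1+O\left(|s|^\delta\right)\right)$$ as $s\uparrow 0$, uniformly for $\boldsymbol{t}\in R$; that is, there exist constants $K>0$ and $s_0<0$ such that $$\left|\frac{1-C_{\boldsymbol{t}}(s)}{|s|\,\|\boldsymbol{t}\|_D}-1\right|\le K|s|^\delta\qquad\text{for all } s\in[s_0,0)\text{ and all }\boldsymbol{t}\in R .$$ *)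

(* Defs.v *)
From HB Require Import structures.
From mathcomp Require Import all_boot all_order all_algebra.
From mathcomp Require Import all_classical all_reals all_analysis.
From mathcomp Require Import measurable_realfun.

Set Implicit Arguments.
Unset Strict Implicit.
Unset Printing Implicit Defensive.

Import Order.TTheory GRing.Theory Num.Theory.
Import numFieldNormedType.Exports.

Local Open Scope classical_set_scope.
Local Open Scope ring_scope.

Lemma measurable_inv (R : realType) : measurable_fun [set: R] (fun u : R => u^-1).
Proof.
have m0 : measurable [set (0 : R)] by exact: measurable_set1.
rewrite -(setUv [set (0 : R)]); apply/measurable_funU => //.
  exact: measurableC.
split; first exact: measurable_fun_set1.
apply: open_continuous_measurable_fun.
  by apply: closed_openC; exact: closed_eq.
move=> u; rewrite inE /= => /eqP u0; exact: inv_continuous.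
Qed.

(* Points of R^d are row vectors; a random vector of dimension d is a family
   of d real random variables on one probability space. *)

Definition is_norm (R : realType) (d : nat) (N : 'rV[R]_d -> R) : Prop :=
  [/\ forall x, N x = 0 -> x = 0,
      forall (a : R) x, N (a *: x) = `|a| * N x
    & forall x y, N (x + y) <= N x + N y].

Section ProbabilitySpace.
Context {R : realType} {disp : measure_display} {T : measurableType disp}.
Variable P : probability T R.

(* The maximum is folded with 0, which is harmless for nonnegative terms. *)
Definition generates (d : nat) (Z : 'I_d -> {RV P >-> R})
    (N : 'rV[R]_d -> R) : Prop :=
  [/\ forall i, {ae P, forall w, 0 <= Z i w},
      forall i, ('E_P[Z i] = 1)%E
    & forall x : 'rV[R]_d,
        ('E_P[(fun w => \big[Num.max/0]_(i < d) (`|x ord0 i| * Z i w))%R]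
         = (N x)%:E)%E].

(* The library's uniform_prob lives on the closed interval [0, 1]; its
   endpoints are null, so this is also the uniform law on (0, 1). *)
Definition is_uniform01 (X : {RV P >-> R}) : Prop :=
  forall A : set R, measurable A ->
    distribution P X A = uniform_prob (@ltr01 R) A.

Definition independent_of_vector (d : nat) (U : {RV P >-> R})
    (Z : 'I_d -> {RV P >-> R}) : Prop :=
  forall (A : set R) (B : set (d.-tuple R)), measurable A -> measurable B ->
    let ZB := [set w | B [tuple Z i w | i < d]] in
    P (U @^-1` A `&` ZB) = (P (U @^-1` A) * P ZB)%E.

Definition rdf (X : {RV P >-> R}) (x : R) : R := fine (cdf X x).

Definition joint_df (d : nat) (X : 'I_d -> T -> R) (x : 'rV[R]_d) : R :=
  fine (P [set w | forall i, X i w <= x ord0 i]).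

(* The copula of V when all the rdf (V i) are continuous. *)
Definition copula_of (d : nat) (V : 'I_d -> {RV P >-> R}) : 'rV[R]_d -> R :=
  joint_df (fun i w => rdf (V i) (V i w)).

Section Ratio.
Variables Y U : {RV P >-> R}.

(* Equal to 0 where U w = 0, a null event when U is uniform. *)
Definition ratio (w : T) : R := (U w)^-1 * Y w.

Let measurable_ratio : measurable_fun setT ratio.
Proof.
apply: measurable_funM => //.
by apply: measurableT_comp => //; exact: measurable_inv.
Qed.

HB.instance Definition _ := isMeasurableFun.Build _ _ T R ratio measurable_ratio.

Definition ratioRV : {RV P >-> R} := ratio.
End Ratio.

End ProbabilitySpace.

Definition is_dnorm (R : realType) (d : nat) (N : 'rV[R]_d -> R) : Prop :=
  is_norm N /\
  exists (disp : measure_display) (T : measurableType disp)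
         (P : probability T R) (Z : 'I_d -> {RV P >-> R}), generates Z N.

Definition is_copula (R : realType) (d : nat) (C : 'rV[R]_d -> R) : Prop :=
  exists (disp : measure_display) (T : measurableType disp)
         (P : probability T R) (X : 'I_d -> {RV P >-> R}),
    (forall i, is_uniform01 (X i)) /\ C = joint_df P (fun i => X i).

Definition is_gpc (R : realType) (d : nat) (N C : 'rV[R]_d -> R) : Prop :=
  [/\ is_dnorm N, is_copula C
    & exists u0 : 'rV[R]_d,
        (forall i, 0 < u0 ord0 i < 1) /\
        forall u : 'rV[R]_d, (forall i, u0 ord0 i <= u ord0 i <= 1) ->
          C u = 1 - N (const_mx 1 - u)].

Definition simplex (R : realType) (d : nat) : set 'rV[R]_d :=
  [set t | (forall i, 0 <= t ord0 i <= 1) /\ \sum_(i < d) t ord0 i = 1].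

Definition along (R : realType) (d : nat) (C : 'rV[R]_d -> R)
    (t : 'rV[R]_d) (s : R) : R := C (const_mx 1 + s *: t).

(* CD enters the estimate only through N, since 1 - along CD t s = `|s| * N t
   for s close to 0, uniformly in t. *)
Definition in_delta_neighborhood (R : realType) (d : nat) (delta : R)
    (C CD N : 'rV[R]_d -> R) : Prop :=
  [/\ is_copula C, is_gpc N CD
    & exists K s0 : R, [/\ 0 < K, s0 < 0
      & forall (s : R) (t : 'rV[R]_d), s0 <= s < 0 -> simplex t ->
          `| (1 - along C t s) / (`|s| * N t) - 1 | <= K * `|s| `^ delta]].

(* Main.v *)
Require Import Defs.
From HB Require Import structures.
From mathcomp Require Import all_boot all_order all_algebra.
From mathcomp Require Import all_classical all_reals all_analysis.
From mathcomp Require Import measurable_realfun ring lra.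

(** Let V_i = Z_i / U have distribution function F_i, and let m x denote the
    maximum of the |x_i| Z_i, so that N x = E (m x).

    The estimate.  Conditioning on Z, the event {U < m x} has probability
    E (min (1, m x)), which lies between N x - K (sum of the x_i ^ 2) and N x,
    where K bounds the second moments of the Z_i ([prob_lt_gmax_le],
    [prob_lt_gmax_ge]).  For one coordinate this reads
    1 / x - K / x ^ 2 <= 1 - F_i(x) <= 1 / x, so that 1 - F_i(V_i) is
    1 / V_i = U / Z_i up to a quadratic error.  Hence the event that
    F_i(V_i) > 1 - |s| t_i for some i, whose probability is 1 - C(1 + s t),
    contains {U < m (|s| t)} and is contained in
    {U < m ((1 + 4 K |s|) |s| t)} ([ratio_exceeds_ge], [ratio_exceeds_le]).
    Applying the bounds once more gives
      |s| N t - K |s| ^ 2 <= 1 - C(1 + s t) <= (1 + 4 K |s|) |s| N t,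
    and N t >= 1 / d on the simplex turns this into a relative error of order
    |s|, uniformly in t ([copula_along_near]).

    The copula.  V_i has no atoms because neither U nor Z_i has, so F_i is
    continuous and F_i(V_i) is uniform by the probability integral transform
    ([ratio_noatom], [rdf_uniform]).

    Existence of a generalized Pareto copula.  On the product of the space of Z
    with Lebesgue measure in r > 0, the r / Z_i behave like the points of an
    exponent measure: each has Lebesgue measure as its image, and {r / Z_i < x_i
    for some i} has mass N x.  For small c the region where some r / Z_i <= c
    has mass at most 1; completing this restriction to a probability, and
    replacing the values of r / Z_i above c by an independent uniform variable
    on [c, 1], gives uniform coordinates whose joint upper tail is exactly N
    ([gpc_coord_tail], [gpc_coord_exceed]). *)

Import Order.TTheory GRing.Theory Num.Theory.
Import numFieldNormedType.Exports.
Local Open Scope classical_set_scope.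
Local Open Scope ring_scope.

Set Implicit Arguments.
Unset Strict Implicit.
Unset Printing Implicit Defensive.

(** * Measurable events and events of full probability *)

Section Events.
Context {d} {T : measurableType d} {R : realType}.

(** Bundles a measurable function as a random variable; the type mentions no
    probability, so the result can be used with any of them. *)
Definition RV_of (f : T -> R) (mf : measurable_fun setT f) : {mfun T >-> R} :=
  HB.pack f (isMeasurableFun.Build _ _ _ _ _ mf).

Lemma measurable_lt (f g : T -> R) : measurable_fun setT f ->
  measurable_fun setT g -> measurable [set w | f w < g w].
Proof.
move=> mf mg; have := measurable_fun_ltr mf mg.
by move=> /(_ measurableT [set true] I); rewrite setTI.
Qed.

Lemma measurable_le (f g : T -> R) : measurable_fun setT f ->
  measurable_fun setT g -> measurable [set w | f w <= g w].
Proof.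
move=> mf mg; have := measurable_fun_ler mf mg.
by move=> /(_ measurableT [set true] I); rewrite setTI.
Qed.

Lemma measurable_eq (f g : T -> R) : measurable_fun setT f ->
  measurable_fun setT g -> measurable [set w | f w = g w].
Proof.
move=> mf mg; have := measurable_fun_eqr mf mg.
move=> /(_ measurableT [set true] I); rewrite setTI.
by congr measurable; apply/seteqP; split => w /= /eqP.
Qed.

Lemma measurable_exists (I : finType) (A : I -> set T) :
  (forall i, measurable (A i)) -> measurable [set w | exists i, A i w].
Proof.
move=> mA; rewrite (_ : [set w | _] = \bigcup_(i in [set: I]) A i).
  by apply: fin_bigcup_measurable => // i _.
by apply/seteqP; split => w /= [i]; [exists i|move=> _; exists i].
Qed.

Lemma measurable_bigmax (I : finType) (f : I -> T -> R) :
  (forall i, measurable_fun setT (f i)) ->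
  measurable_fun setT (fun w => \big[Num.max/0]_i f i w).
Proof.
move=> mf.
have : forall s, measurable_fun setT (fun w => \big[Num.max/0]_(i <- s) f i w).
  elim=> [|i s IHs]; first by under eq_fun do rewrite big_nil; exact: measurable_cst.
  by under eq_fun do rewrite big_cons; exact: measurable_maxr.
exact.
Qed.

Context (P : probability T R).

(** Inclusions between events are needed only where the uniform variables stay
    in their range, an event of probability one; this is how that range is
    assumed for free. *)
Lemma le_prob_on (G A B : set T) : measurable G -> measurable A ->
  measurable B -> P G = 1%E -> A `&` G `<=` B -> (P A <= P B)%E.
Proof.
move=> mG mA mB PG AGB.
have PGc : P (~` G) = 0%E by rewrite probability_setC// PG subee.
have mGc : measurable (~` G) by exact: measurableC.
apply: (@le_trans _ _ (P (B `|` ~` G))).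
  rewrite le_measure ?inE//; first exact: measurableU.
  by move=> w Aw; have [Gw|] := pselect (G w); [left; exact: AGB|right].
by rewrite (le_trans (measureU2 _ _ _))// [X in (_ + X)%E]PGc adde0.
Qed.
End Events.

(** * The uniform law on the unit interval *)

Section Uniform.
Context {R : realType}.
Local Notation unif := (uniform_prob (@ltr01 R)).

Lemma uniform01E (A : set R) : measurable A ->
  unif A = lebesgue_measure (A `&` `[0, 1]).
Proof.
move=> mA; rewrite /uniform_prob integral_uniform_pdf.
rewrite (eq_integral (cst 1%E)); last first.
  move=> x; rewrite inE/= in_itv/= => -[_ x01].
  by rewrite /uniform_pdf x01 subr0 invr1.
by rewrite integral_cst ?mul1e//; exact: measurableI.
Qed.

Lemma uniform01_set1 (a : R) : unif [set a] = 0%E.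
Proof.
rewrite uniform01E//; apply/eqP; rewrite -measure_le0 -(lebesgue_measure_set1 a).
by rewrite le_measure ?inE//; exact: measurableI.
Qed.

Lemma uniform01_lt (a : R) :
  unif `]-oo, a[ = (Num.min 1 (Num.max 0 a))%:E.
Proof.
rewrite uniform01E//.
have [a0|a0] := leP a 0.
  rewrite min_r ?ler01// (_ : _ `&` _ = set0) ?measure0//.
  rewrite -subset0 => x /=; rewrite !in_itv/= => -[xa /andP[x0 _]].
  by have := lt_le_trans xa (le_trans a0 x0); rewrite ltxx.
have [a1|a1] := leP 1 a.
  have [a1'|a1'] := ltP 1 a.
    rewrite (setIidr _).
      by rewrite lebesgue_measure_itv/= lte_fin ltr01 oppr0 adde0.
    by move=> x /=; rewrite !in_itv/= => /andP[_ x1]; exact: le_lt_trans a1'.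
  have -> : a = 1 by apply/le_anti; rewrite a1 a1'.
  rewrite (_ : _ `&` _ = `[0, 1[%classic).
    by rewrite lebesgue_measure_itv/= lte_fin ltr01 oppr0 adde0.
  apply/seteqP; split => x /=; rewrite !in_itv/=.
    by move=> [-> /andP[->]].
  by move=> /andP[-> x1]; rewrite x1 ltW.
rewrite (_ : _ `&` _ = `[0, a[%classic).
  by rewrite lebesgue_measure_itv/= lte_fin a0 oppr0 adde0.
apply/seteqP; split => x /=; rewrite !in_itv/=.
  by move=> [-> /andP[->]].
by move=> /andP[-> xa]; rewrite xa (ltW (lt_trans xa a1)).
Qed.

Lemma uniform01_gt (a : R) : 0 <= a -> unif `]a, +oo[ = (1 - Num.min 1 a)%:E.
Proof.
move=> a0.
have -> : `]a, +oo[%classic = ~` (`]-oo, a[ `|` [set a]).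
  rewrite -setCitvl; congr (~` _); apply/seteqP; split => x /=; rewrite !in_itv/=.
    by rewrite le_eqVlt => /predU1P[->|->]; [right|left].
  by case=> [/ltW//|->].
rewrite probability_setC; last exact: measurableU.
rewrite measureU//=.
  by rewrite uniform01_set1 uniform01_lt max_r// addr0 -EFinB.
by apply/seteqP; split => x //=; rewrite in_itv/= => -[+ xa]; rewrite xa ltxx.
Qed.

Context {d} {T : measurableType d} (P : probability T R).

(** The open upper rays form a pi-system generating the Borel sets, so they
    determine a law; outside [0, 1[ the tails are forced by monotonicity. *)
Lemma is_uniform01_gt (X : {RV P >-> R}) :
  (forall y, 0 <= y < 1 -> P [set w | y < X w] = (1 - y)%:E) -> is_uniform01 X.
Proof.
move=> Xy A mA.
(* The uniform law lives on the copy of R that carries Lebesgue measure; its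
   image under the identity is a measure on the Borel type of R itself. *)
have mid : measurable_fun [set: measurableTypeR R] (idfun : _ -> R).
  by move=> _ B mB; rewrite setTI.
pose idR : {mfun measurableTypeR R >-> R} :=
  HB.pack (idfun : measurableTypeR R -> R)
    (isMeasurableFun.Build _ _ _ _ _ mid).
apply: (@measure_unique _ R _ (@RGenOInfty.G R) (fun n => `]- n%:R, +oo[%classic)
  _ _ _ _ (distribution P X) (distribution unif idR)) => //.
- exact: RGenOInfty.measurableE.
- move=> _ _ [x ->] [y ->]; exists (Num.max x y).
  apply/seteqP; split => z /=; rewrite !in_itv/= !andbT gt_max.
    by move=> [-> ->].
  by move=> /andP.
- by move=> n; exists (- n%:R).
- apply/seteqP; split => // x _; have xn := archi_boundP (normr_ge0 x).
  exists (Num.bound `|x|) => //=; rewrite in_itv/= andbT ltrNl.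
  by apply: le_lt_trans xn; rewrite ler_normr lexx orbT.
- move=> _ [y ->].
  transitivity (P [set w | y < X w]).
    rewrite /distribution /pushforward; congr (P _); apply/seteqP.
    by split => w /=; rewrite in_itv/= andbT.
  change (P [set w | y < X w] = unif `]y, +oo[).
  have mX z : measurable [set w | z < X w] by exact: measurable_lt.
  have [y0|y0] := ltP y 0.
    transitivity (1 : \bar R)%E.
      apply/eqP; rewrite eq_le probability_le1//=.
      apply: (@le_trans _ _ (P [set w | 0 < X w])).
        by rewrite Xy ?lexx ?ltr01// subr0.
      by rewrite le_measure ?inE// => w /=; exact: lt_trans.
    apply/esym/eqP; rewrite eq_le probability_le1//=.
    apply: (@le_trans _ _ (unif `]0, +oo[)).
      by rewrite uniform01_gt// min_r// subr0.
    by rewrite le_measure ?inE// => w /=; rewrite !in_itv/= !andbT; exact: lt_trans.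
  have [y1|y1] := ltP y 1.
    by rewrite Xy ?y0// uniform01_gt// min_r// ltW.
  rewrite uniform01_gt// min_l// subrr.
  apply/eqP; rewrite -measure_le0; apply/lee_addgt0Pr => e e0; rewrite add0e.
  have [e1|e1] := leP e 1; last first.
    by apply: (le_trans (probability_le1 _ _)) => //; rewrite lee_fin ltW.
  rewrite (_ : e = 1 - (1 - e)); last by rewrite subKr.
  rewrite -Xy ?subr_ge0 ?e1 ?ltrBlDr ?ltrDl//.
  rewrite le_measure ?inE// => w /=; apply: lt_trans.
  by apply: lt_le_trans y1; rewrite ltrBlDr ltrDl.
- by move=> n; rewrite (le_lt_trans (probability_le1 _ _))// ltry.
Qed.

End Uniform.

(** * A uniform variable independent of a random vector *)

Section IndependentUniform.
Context {R : realType} {d : nat} {disp} {T : measurableType disp}.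
Context {P : probability T R}.
Variables (Z : 'I_d -> {RV P >-> R}) (U : {RV P >-> R}).
Hypotheses (U_unif : is_uniform01 U) (U_indep : independent_of_vector U Z).

Let Zt w : d.-tuple R := [tuple Z i w | i < d].

Let measurable_Zt : measurable_fun setT Zt.
Proof.
apply/measurable_fun_tnthP => i.
rewrite (_ : _ \o _ = Z i)//; apply/funext => w /=.
by rewrite tnth_mktuple.
Qed.

(** Conditioning on Z: by independence the joint law of (Z, U) is the product
    of the marginals, since the two agree on rectangles. *)
Lemma independent_uniform_prob (E : set (d.-tuple R * R)) : measurable E ->
  P [set w | E (Zt w, U w)] =
  (\int[P]_w uniform_prob (@ltr01 R) (xsection E (Zt w)))%E.
Proof.
move=> mE.
pose Zf : {mfun T >-> d.-tuple R} :=
  HB.pack Zt (isMeasurableFun.Build _ _ _ _ _ measurable_Zt).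
have mZU : measurable_fun setT (fun w => (Zt w, U w)).
  exact: measurable_fun_pair.
pose ZU : {mfun T >-> (d.-tuple R * R)%type} :=
  HB.pack (fun w => (Zt w, U w)) (isMeasurableFun.Build _ _ _ _ _ mZU).
transitivity (distribution P ZU E) => //.
rewrite -(@product_measure_unique _ _ _ _ R (distribution P Zf) (distribution P U));
    [|move=> A B mA mB|exact: mE]; last first.
  rewrite /distribution /pushforward muleC.
  have := U_indep mB mA => /= <-; congr (P _).
  by apply/seteqP; split => w /= [].
rewrite /product_measure1 ge0_integral_distribution//; last first.
  exact: measurable_fun_xsection.
by apply: eq_integral => w _ /=; rewrite U_unif//; exact: measurable_xsection.
Qed.

(** The section of {u < f z} at z is a ray, whose uniform mass is f z clamped
    to [0, 1]. *)
Lemma independent_uniform_lt (f : d.-tuple R -> R) : measurable_fun setT f ->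
  P [set w | U w < f (Zt w)] = ('E_P[(fun w => Num.min 1 (Num.max 0 (f (Zt w))))%R])%E.
Proof.
move=> mf; pose E := [set zu : d.-tuple R * R | zu.2 < f zu.1].
have mE : measurable E.
  by apply: measurable_lt => //; exact: (measurableT_comp mf measurable_fst).
rewrite (independent_uniform_prob mE) unlock; apply: eq_integral => w _.
rewrite -uniform01_lt; congr (uniform_prob _ _).
by apply/seteqP; split => u /=; rewrite in_itv/= /xsection /E/= inE.
Qed.

Lemma independent_uniform_eq (f : d.-tuple R -> R) : measurable_fun setT f ->
  P [set w | U w = f (Zt w)] = 0%E.
Proof.
move=> mf; pose E := [set zu : d.-tuple R * R | zu.2 = f zu.1].
have mE : measurable E.
  by apply: measurable_eq => //; exact: (measurableT_comp mf measurable_fst).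
rewrite (independent_uniform_prob mE); apply: integral0_eq => w _.
rewrite (_ : xsection _ _ = [set f (Zt w)]) ?uniform01_set1//.
by apply/seteqP; split => u /=; rewrite /xsection /E/= inE.
Qed.

Lemma uniform01_gt0 : P [set w | 0 < U w] = 1%E.
Proof.
rewrite (_ : [set w | 0 < U w] = U @^-1` `]0, +oo[).
  transitivity (distribution P U `]0, +oo[) => //.
  by rewrite U_unif// uniform01_gt// min_r// subr0.
by apply/seteqP; split => w /=; rewrite in_itv/= andbT.
Qed.

End IndependentUniform.

(** * Distribution functions and the probability integral transform *)

Section Rdf.
Context {d} {T : measurableType d} {R : realType} (P : probability T R).
Implicit Types X : {RV P >-> R}.

Lemma rdfE X x : (rdf X x)%:E = P [set w | X w <= x].
Proof.
rewrite /rdf /cdf /distribution /pushforward fineK ?fin_num_measure//.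
exact: (measurable_funPTI X (measurable_itv `]-oo, x])).
Qed.

Lemma rdf_gtE X x : P [set w | x < X w] = (1 - rdf X x)%:E.
Proof.
rewrite EFinB rdfE -probability_setC; last exact: measurable_le.
by congr (P _); apply/seteqP; split => w /=; rewrite ltNge => /negP.
Qed.

Lemma le_rdf X : {homo rdf X : x y / x <= y}.
Proof.
move=> x y xy; rewrite -lee_fin !rdfE le_measure ?inE//.
- exact: measurable_le.
- exact: measurable_le.
- by move=> w /= /le_trans; exact.
Qed.

Lemma measurable_rdf X : measurable_fun setT (rdf X).
Proof. by apply: nondecreasing_measurable => // x y; exact: le_rdf. Qed.

(** An atom at x would be a jump of the distribution function at x. *)
Lemma prob_eq_of_continuous X x : continuous (rdf X) -> P [set w | X w = x] = 0%E.
Proof.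
move=> cX; apply/eqP; rewrite -measure_le0; apply/lee_addgt0Pr => e e0.
rewrite add0e.
have /cvgrPdist_le /(_ _ e0) := cX x.
rewrite /= nearE => /nbhs_ballP[r /= r0] /(_ (x - r / 2)).
rewrite /ball/= opprD addNKr opprK gtr0_norm ?divr_gt0//.
rewrite ltr_pdivrMr// ltr_pMr// ltr1n => /(_ isT) h.
have {h} := le_trans (ler_norm _) h.
have lt_rx : x - r / 2 < x by rewrite ltrBlDr ltrDl divr_gt0.
rewrite -lee_fin EFinB; apply: le_trans; rewrite leeBrDr//.
rewrite rdfE -measureU.
- rewrite rdfE le_measure ?inE//.
  + by apply: measurableU; [exact: measurable_eq|exact: measurable_le].
  + exact: measurable_le.
  + by move=> w /= [->//|] /le_trans; apply; exact: ltW.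
- exact: measurable_eq.
- exact: measurable_le.
- apply/seteqP; split => w //= [->].
  by rewrite leNgt lt_rx.
Qed.

(** Distribution functions are right-continuous.  Without atoms, that of X at
    -y is one minus that of -X at y, so left-continuity of the former is
    right-continuity of the latter. *)
Lemma rdf_continuous X : (forall x, P [set w | X w = x] = 0%E) ->
  continuous (rdf X).
Proof.
move=> X0 x.
have rc Y : right_continuous (rdf Y).
  move=> a; apply: fine_cvg; rewrite fineK ?fin_num_measure//.
  exact: cdf_right_continuous.
apply/left_right_continuousP; split; last exact: rc.
apply/cvg_at_leftNP.
have mXN : measurable_fun setT (fun w => - X w) by exact: measurableT_comp.
pose Y : {RV P >-> R} := RV_of mXN.
have E y : rdf X (- y) = 1 - rdf Y y.
  apply: EFin_inj; rewrite -rdf_gtE rdfE.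
  rewrite -[RHS]adde0 -(X0 (- y)) -measureU.
  - congr (P _); apply/seteqP; split => w /=; rewrite ltrNr le_eqVlt.
      by move=> /predU1P[->|]; [right|left].
    by case=> [->|->]; rewrite ?eqxx ?orbT.
  - exact: measurable_lt.
  - exact: measurable_eq.
  - by apply/seteqP; split => w //= []; rewrite ltrNr => /[swap] ->; rewrite ltxx.
rewrite (_ : rdf X \o -%R = fun y => 1 - rdf Y y); last first.
  by apply/funext => y /=; rewrite E.
rewrite -[x in rdf X x]opprK E; apply: cvgB; first exact: cvg_cst.
exact: rc.
Qed.

Lemma rdf_surj X y : continuous (rdf X) -> 0 < y < 1 -> exists x, rdf X x = y.
Proof.
move=> cX /andP[y0 y1].
have [a ya] : exists a, rdf X a < y.
  have /fine_cvg /cvgrPdist_lt /(_ _ y0) := cvg_cdfNy0 X.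
  case=> a [_ /(_ (a - 1))]; rewrite ltrBlDr ltrDl ltr01 => /(_ isT) /=.
  rewrite sub0r normrN => h; exists (a - 1).
  by apply: le_lt_trans h; exact: ler_norm.
have [b yb] : exists b, y < rdf X b.
  have y1' : 0 < 1 - y by rewrite subr_gt0.
  have /fine_cvg /cvgrPdist_lt /(_ _ y1') := cvg_cdfy1 X.
  case=> b [_ /(_ (b + 1))]; rewrite ltrDl ltr01 => /(_ isT) /= h.
  exists (b + 1).
  by have := le_lt_trans (ler_norm _) h; rewrite ltrD2l ltrN2.
have ab : a <= b.
  rewrite leNgt; apply/negP => /ltW /(le_rdf X).
  by rewrite leNgt (lt_trans ya yb).
have [c _ cy] := @IVT _ (rdf X) a b y ab (continuous_subspaceT cX)
  ltac:(by rewrite ge_min le_max (ltW ya) (ltW yb) orbT).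
by exists c.
Qed.

(** The probability integral transform.  The distribution function F need not
    be injective, so {F(X) > y} is squeezed between {X > x'} and {X > x} for
    preimages x' of y + e and x of y. *)
Lemma rdf_uniform X (mFX : measurable_fun setT (fun w => rdf X (X w))) :
  continuous (rdf X) -> is_uniform01 (RV_of mFX : {RV P >-> R}).
Proof.
move=> cX; apply: is_uniform01_gt => y /andP[y0 y1].
change (P [set w | y < rdf X (X w)] = (1 - y)%:E).
have mF z : measurable [set w | z < rdf X (X w)] by exact: measurable_lt.
apply/eqP; rewrite eq_le; apply/andP; split.
  have [->|yN0] := eqVneq y 0; first by rewrite subr0 probability_le1.
  have {}y0 : 0 < y by rewrite lt_def yN0.
  have [x xy] := @rdf_surj X y cX ltac:(by rewrite y0 y1).
  rewrite -xy -rdf_gtE le_measure ?inE//; first exact: measurable_lt.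
  by move=> w /=; apply: contraTT; rewrite -!leNgt; exact: le_rdf.
apply/lee_addgt0Pr => e e0.
have [ye|ye] := leP 1 (y + e).
  apply: (@le_trans _ _ e%:E); last by rewrite leeDr.
  by rewrite lee_fin lerBlDr addrC.
have [x xy] := @rdf_surj X (y + e) cX ltac:(by rewrite ye ltr_wpDl).
rewrite -leeBlDr// -EFinB -addrA -opprD -xy -rdf_gtE.
rewrite le_measure ?inE//; first exact: measurable_lt.
move=> w /= xX; apply: (@lt_le_trans _ _ (rdf X x)).
  by rewrite xy ltrDl.
by rewrite le_rdf// ltW.
Qed.

End Rdf.

(** * The copula of Z / U near its upper corner *)

Section Neighborhood.
Context {R : realType} {d : nat} {disp} {T : measurableType disp}.
Context {P : probability T R}.
Variables (Z : 'I_d -> {RV P >-> R}) (U : {RV P >-> R}) (N : 'rV[R]_d -> R).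

(** The integrand of the D-norm generated by Z. *)
Definition gmax (x : 'rV[R]_d) (w : T) : R :=
  \big[Num.max/0]_(i < d) (`|x ord0 i| * Z i w).

Lemma gmax_ge0 x w : 0 <= gmax x w.
Proof. exact: bigmax_ge_id. Qed.

Lemma measurable_gmax x : measurable_fun setT (gmax x).
Proof. by apply: measurable_bigmax => i; exact: measurable_funM. Qed.

Lemma lt_gmaxP x w u : 0 <= u ->
  (u < gmax x w) <-> (exists i, u < `|x ord0 i| * Z i w).
Proof.
move=> u0; split => [/bigmax_gtP|[i ui]].
  by rewrite ltNge u0 /= => -[//|[i _ ui]]; exists i.
by apply/bigmax_gtP; right; exists i.
Qed.

Lemma gmax_delta i c w : gmax (c *: delta_mx ord0 i) w = Num.max 0 (`|c| * Z i w).
Proof.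
apply/eqP; rewrite eq_le; apply/andP; split.
  apply/bigmax_leP; split; first by rewrite le_max lexx.
  move=> j _; rewrite !mxE eqxx/=; have [->|] := eqVneq j i.
    by rewrite mulr1 le_max lexx orbT.
  by move=> _; rewrite mulr0 normr0 mul0r le_max lexx.
rewrite ge_max gmax_ge0/=.
apply: (le_trans _ (le_bigmax _ _ i)) => //=.
by rewrite !mxE !eqxx mulr1.
Qed.

(** The maximum is either 0 or one of its terms. *)
Lemma gmax_sqr x w : (gmax x w) ^+ 2 <= \sum_i (x ord0 i) ^+ 2 * (Z i w) ^+ 2.
Proof.
have S0 (i : 'I_d) : 0 <= (x ord0 i) ^+ 2 * (Z i w) ^+ 2.
  by rewrite mulr_ge0 ?sqr_ge0.
rewrite /gmax; apply: (big_ind (fun m => m ^+ 2 <= _)).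
- by rewrite expr0n/= sumr_ge0.
- by move=> a b ha hb; case: (leP a b).
- move=> i _; rewrite exprMn real_normK ?num_real// (bigD1 i)//= lerDl.
  by rewrite sumr_ge0.
Qed.

Hypothesis N_norm : is_norm N.
Hypothesis Z_gen : generates Z N.

Lemma gmaxE x : (\int[P]_w (gmax x w)%:E = (N x)%:E)%E.
Proof. by case: Z_gen => _ _ /(_ x); rewrite unlock. Qed.

Lemma dnorm_homo c x : 0 <= c -> N (c *: x) = c * N x.
Proof. by move=> c0; case: N_norm => _ -> _; rewrite ger0_norm. Qed.

(** Here nonnegativity of Z and E(Z_i) = 1 enter. *)
Lemma dnorm_delta i : N (delta_mx ord0 i) = 1.
Proof.
apply: EFin_inj; rewrite -gmaxE.
case: Z_gen => /(_ i) Zi0 /(_ i) <- _; rewrite unlock.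
apply: ae_eq_integral => //.
- by apply/measurable_EFinP; exact: measurable_gmax.
- exact/measurable_EFinP.
apply: filterS Zi0 => w Zw _ /=.
by rewrite -[delta_mx _ _]scale1r gmax_delta normr1 mul1r max_r.
Qed.

Lemma le_dnorm (i : 'I_d) (x : 'rV[R]_d) : 0 <= x ord0 i -> x ord0 i <= N x.
Proof.
move=> xi0; have /esym := dnorm_homo (delta_mx ord0 i) xi0.
rewrite dnorm_delta mulr1 => ->; rewrite -lee_fin -!gmaxE.
apply: ge0_le_integral => //.
- by move=> w _; rewrite lee_fin gmax_ge0.
- by apply/measurable_EFinP; exact: measurable_gmax.
- by apply/measurable_EFinP; exact: measurable_gmax.
- move=> w _; rewrite lee_fin gmax_delta ge_max gmax_ge0/=.
  exact: (le_trans _ (le_bigmax _ _ i)).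
Qed.

Hypotheses (U_unif : is_uniform01 U) (U_indep : independent_of_vector U Z).
Variable K : R.
Hypotheses (K1 : 1 <= K) (ZK : forall i, (\int[P]_w ((Z i w) ^+ 2)%:E <= K%:E)%E).

(** Where U > 0, the event {U < gmax x} says that Z_i / U > 1 / |x_i| for some
    i with x_i != 0. *)
Lemma prob_lt_gmax x : P [set w | U w < gmax x w] =
  (\int[P]_w (Num.min 1 (gmax x w))%:E)%E.
Proof.
pose f (z : d.-tuple R) := \big[Num.max/0]_(i < d) (`|x ord0 i| * tnth z i).
have mf : measurable_fun setT f.
  apply: measurable_bigmax => i; apply: measurable_funM => //.
  exact: measurable_tnth.
have fE w : f [tuple Z i w | i < d] = gmax x w.
  by apply: eq_bigr => i _; rewrite tnth_mktuple.
have := independent_uniform_lt U_unif U_indep mf.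
under eq_set do rewrite fE; move=> ->; rewrite unlock.
by apply: eq_integral => w _; rewrite fE max_r// gmax_ge0.
Qed.

Let measurable_min_gmax x : measurable_fun setT (fun w => (Num.min 1 (gmax x w))%:E).
Proof.
by apply/measurable_EFinP; apply: measurable_minr => //; exact: measurable_gmax.
Qed.

Lemma prob_lt_gmax_le x : (P [set w | U w < gmax x w]%R <= (N x)%:E)%E.
Proof.
rewrite prob_lt_gmax -gmaxE; apply: ge0_le_integral => //.
- by move=> w _; rewrite lee_fin le_min ler01 gmax_ge0.
- by apply/measurable_EFinP; exact: measurable_gmax.
- by move=> w _; rewrite lee_fin ge_min lexx orbT.
Qed.

(** From m <= min(1, m) + m ^ 2 for m >= 0: the second moments control what is
    lost by truncating at 1. *)
Lemma prob_lt_gmax_ge x :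
  ((N x - K * \sum_i (x ord0 i) ^+ 2)%:E <= P [set w | U w < gmax x w]%R)%E.
Proof.
rewrite EFinB leeBlDr// prob_lt_gmax -gmaxE.
have mZ2 i : measurable_fun setT (fun w => ((Z i w) ^+ 2)%:E).
  by apply/measurable_EFinP; exact: measurable_funX.
have m2 : measurable_fun setT (fun w => (gmax x w ^+ 2)%:E).
  by apply/measurable_EFinP/measurable_funX; exact: measurable_gmax.
apply: (@le_trans _ _ (\int[P]_w ((Num.min 1 (gmax x w))%:E + (gmax x w ^+ 2)%:E))%E).
  apply: ge0_le_integral => //.
  - by move=> w _; rewrite lee_fin gmax_ge0.
  - by apply/measurable_EFinP; exact: measurable_gmax.
  - exact: emeasurable_funD.
  - move=> w _; rewrite -EFinD lee_fin.
    have [m1|/ltW m1] := leP 1 (gmax x w); last by rewrite lerDl sqr_ge0.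
    by rewrite expr2 (le_trans (ler_peMl (gmax_ge0 _ _) m1))// lerDr.
rewrite ge0_integralD//; last 2 first.
- by move=> w _; rewrite lee_fin le_min ler01 gmax_ge0.
- by move=> w _; rewrite lee_fin sqr_ge0.
rewrite leeD2l//.
apply: (@le_trans _ _ (\int[P]_w (\sum_i ((x ord0 i) ^+ 2)%:E * ((Z i w) ^+ 2)%:E))%E).
  apply: ge0_le_integral => //.
  - by move=> w _; rewrite lee_fin sqr_ge0.
  - by apply: emeasurable_sum => i; exact: emeasurable_funM.
  - by move=> w _; under eq_bigr do rewrite -EFinM; rewrite sumEFin lee_fin gmax_sqr.
rewrite ge0_integral_sum//; last 2 first.
- by move=> i; exact: emeasurable_funM.
- by move=> i w _; rewrite -EFinM lee_fin mulr_ge0 ?sqr_ge0.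
rewrite mulr_sumr -sumEFin; apply: lee_sum => i _.
rewrite ge0_integralZl//; last 2 first.
- by move=> w _; rewrite lee_fin sqr_ge0.
- by rewrite lee_fin sqr_ge0.
by rewrite (mulrC K) [leRHS]EFinM; apply: lee_wpmul2l => //; rewrite lee_fin sqr_ge0.
Qed.

Let V i : {RV P >-> R} := ratioRV (Z i) U.

Let mU0 : measurable [set w | 0 < U w].
Proof. exact: measurable_lt. Qed.

Let U0 : P [set w | 0 < U w] = 1%E.
Proof. exact: uniform01_gt0. Qed.

Let measurable_lt_gmax x : measurable [set w | U w < gmax x w].
Proof. by apply: measurable_lt => //; exact: measurable_gmax. Qed.

(** Let V_i be Z_i / U, with distribution function F_i.  Taking a multiple of
    a basis vector for x in the bounds on {U < gmax x} gives
    1 / x - K / x ^ 2 <= 1 - F_i(x) <= 1 / x. *)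
Lemma lt_ratio i x w : 0 < x -> 0 < U w ->
  (x < V i w) = (U w < x^-1 * Z i w).
Proof.
move=> x0 u0; by rewrite /V /= /ratio ltr_pdivlMl// ltr_pdivlMl// mulrC.
Qed.

Lemma prob_ratio_gt i x : 0 < x ->
  P [set w | x < V i w] = P [set w | U w < gmax (x^-1 *: delta_mx ord0 i) w].
Proof.
move=> x0; have mV : measurable [set w | x < V i w] by exact: measurable_lt.
have xV w : 0 < U w -> x < V i w <-> U w < gmax (x^-1 *: delta_mx ord0 i) w.
  move=> u0; rewrite lt_ratio// gmax_delta lt_max ltNge (ltW u0)/=.
  by rewrite gtr0_norm ?invr_gt0.
apply/eqP; rewrite eq_le; apply/andP; split; apply: (le_prob_on mU0) => //.
- by move=> w [xw u0]; apply/xV.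
- by move=> w [xw u0]; apply/xV.
Qed.

Lemma rdf_ratio_le i x : 0 < x -> 1 - rdf (V i) x <= x^-1.
Proof.
move=> x0; rewrite -lee_fin -rdf_gtE prob_ratio_gt//.
apply: (le_trans (prob_lt_gmax_le _)).
by rewrite lee_fin dnorm_homo ?invr_ge0 ?(ltW x0)// dnorm_delta mulr1.
Qed.

Lemma rdf_ratio_ge i x : 0 < x -> x^-1 - K * x^-1 ^+ 2 <= 1 - rdf (V i) x.
Proof.
move=> x0; rewrite -lee_fin -rdf_gtE prob_ratio_gt//.
apply: (le_trans _ (prob_lt_gmax_ge _)).
rewrite lee_fin dnorm_homo ?invr_ge0 ?(ltW x0)// dnorm_delta mulr1.
rewrite (bigD1 i)//= !mxE !eqxx mulr1 big1 ?addr0// => j ji.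
by rewrite !mxE eqxx (negbTE ji) mulr0 expr0n.
Qed.

(** From 1 - F_i(x) <= 1 / x, as the second condition reads 1 / V_i < e. *)
Lemma ratio_exceeds_ge i e w : 0 < U w -> U w < e * Z i w -> 0 < e ->
  1 - e < rdf (V i) (V i w).
Proof.
move=> u0 uZ e0.
have eV : e^-1 < V i w by rewrite lt_ratio ?invr_gt0// invrK.
have V0 : 0 < V i w by apply: lt_trans eV; rewrite invr_gt0.
rewrite ltrBlDr -ltrBlDl; apply: (le_lt_trans (rdf_ratio_le i V0)).
by rewrite -[e]invrK ltf_pV2// posrE invr_gt0.
Qed.

(** With a = 1 / V_i, the lower bound on the tail gives a - K a ^ 2 < e.  This
    pins a near e when V_i > 2 K; and V_i <= 2 K is impossible, because
    1 - F_i(2 K) >= 1 / (4 K) >= e. *)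
Lemma ratio_exceeds_le i e w : 0 < U w -> 0 <= e -> e <= (4 * K)^-1 ->
  1 - e < rdf (V i) (V i w) -> U w < (e + 4 * K * e ^+ 2) * Z i w.
Proof.
move=> u0 e0 eK; rewrite ltrBlDr -ltrBlDl => Fe.
have K0 : 0 < K by exact: lt_le_trans K1.
have VK : 2 * K < V i w.
  rewrite ltNge; apply/negP => /(le_rdf (V i)) VK.
  have := rdf_ratio_ge i (_ : 0 < 2 * K); rewrite mulr_gt0// => /(_ isT).
  have -> : (2 * K)^-1 - K * (2 * K)^-1 ^+ 2 = (4 * K)^-1 by field; lra.
  by move=> h; have := lt_le_trans Fe eK; rewrite ltNge (le_trans h)// lerB.
have V0 : 0 < V i w by apply: lt_trans VK; rewrite mulr_gt0.
have /le_lt_trans /(_ Fe) := rdf_ratio_ge i V0.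
set a := (V i w)^-1 => ae.
have a0 : 0 < a by rewrite invr_gt0.
have aK : a * (2 * K) < 1 by rewrite /a mulrC ltr_pdivrMr// mul1r.
have Ka2 : a * (a * (2 * K)) < a * 1 by rewrite ltr_pM2l.
have a2e : a < 2 * e by rewrite expr2 in ae; lra.
have Ke2 : K * (a * a) < K * (2 * e * (2 * e)).
  by rewrite ltr_pM2l// ltr_pM// ltW.
have -> : Z i w = V i w * U w.
  by rewrite /V /= /ratio mulrAC mulVf ?mul1r// gt_eqF.
rewrite mulrA ltr_pMl// -ltr_pdivrMr// div1r -/a.
by rewrite expr2 in ae *; lra.
Qed.

Let mF i : measurable_fun setT (fun w => rdf (V i) (V i w)).
Proof. by apply: measurableT_comp => //; exact: measurable_rdf. Qed.

Lemma copula_along_compl (t : 'rV[R]_d) (s : R) :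
  (1 - along (copula_of V) t s)%:E =
  P [set w | exists i, 1 + s * t ord0 i < rdf (V i) (V i w)].
Proof.
rewrite /along /copula_of /joint_df.
have -> : [set w | forall i, rdf (V i) (V i w) <= (const_mx 1 + s *: t) ord0 i] =
    ~` [set w | exists i, 1 + s * t ord0 i < rdf (V i) (V i w)].
  apply/seteqP; split => w /= h.
    by move=> [i]; have := h i; rewrite !mxE leNgt => /negP.
  by move=> i; rewrite !mxE leNgt; apply/negP => hi; apply: h; exists i.
have mA : measurable [set w | exists i, 1 + s * t ord0 i < rdf (V i) (V i w)].
  by apply: measurable_exists => i; exact: measurable_lt.
rewrite probability_setC// fineB ?fin_num_measure//=.
by rewrite subKr fineK// fin_num_measure.
Qed.

(** Put e_i = |s| t_i.  Since e_i <= |s|, the correction 4 K e_i ^ 2 is at most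
    4 K |s| e_i, so it rescales t by a common factor that the norm pulls out. *)
Lemma copula_along_le (t : 'rV[R]_d) (s : R) : simplex t ->
  - (4 * K)^-1 <= s -> s <= 0 ->
  1 - along (copula_of V) t s <= (1 + 4 * K * `|s|) * `|s| * N t.
Proof.
move=> [t01 _] sK s0; have s0' := ler0_norm s0.
have K0 : 0 < K by exact: lt_le_trans K1.
have c0 : 0 <= (1 + 4 * K * `|s|) * `|s|.
  by rewrite mulr_ge0// addr_ge0// !mulr_ge0// ltW.
rewrite -dnorm_homo// -lee_fin copula_along_compl.
apply: le_trans (prob_lt_gmax_le _).
apply: (le_prob_on mU0) => //.
  by apply: measurable_exists => i; exact: measurable_lt.
move=> w /= [[i ti] u0]; apply/lt_gmaxP; first exact: ltW.
have /andP[ti0 ti1] := t01 i.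
exists i.
have e0 : 0 <= - (s * t ord0 i) by rewrite -mulNr mulr_ge0 ?oppr_ge0.
have eS : - (s * t ord0 i) <= - s by rewrite -mulNr ler_piMr ?oppr_ge0.
have eK : - (s * t ord0 i) <= (4 * K)^-1 by rewrite (le_trans eS)// lerNl.
have h : U w < (- (s * t ord0 i) + 4 * K * (- (s * t ord0 i)) ^+ 2) * Z i w.
  by apply: ratio_exceeds_le => //; rewrite opprK.
have Z0 : 0 < Z i w.
  rewrite ltNge; apply/negP => Z0; have := lt_trans u0 h.
  rewrite ltNge mulr_ge0_le0// addr_ge0// mulr_ge0 ?sqr_ge0//.
  by rewrite mulr_ge0// ltW.
apply: (lt_le_trans h); rewrite ler_pM2r// !mxE normrM (ger0_norm c0).
rewrite (ger0_norm ti0) s0' -subr_ge0.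
have -> : (1 + 4 * K * - s) * - s * t ord0 i -
    (- (s * t ord0 i) + 4 * K * (- (s * t ord0 i)) ^+ 2) =
    4 * K * s ^+ 2 * (t ord0 i * (1 - t ord0 i)) by ring.
by apply: mulr_ge0; apply: mulr_ge0; rewrite ?subr_ge0 ?sqr_ge0// mulr_ge0// ltW.
Qed.

(** The loss is K times the sum of the (|s| t_i) ^ 2, and t_i ^ 2 <= t_i. *)
Lemma copula_along_ge (t : 'rV[R]_d) (s : R) : simplex t -> s <= 0 ->
  `|s| * N t - K * `|s| ^+ 2 <= 1 - along (copula_of V) t s.
Proof.
move=> [t01 t1] s0; have s0' := ler0_norm s0.
have K0 : 0 < K by exact: lt_le_trans K1.
rewrite -lee_fin copula_along_compl.
apply: (@le_trans _ _ (P [set w | U w < gmax (`|s| *: t) w])); last first.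
  apply: (le_prob_on mU0) => //.
    by apply: measurable_exists => i; exact: measurable_lt.
  move=> w /= [Uw u0]; move/lt_gmaxP : Uw => [|i]; first exact: ltW.
  have /andP[ti0 ti1] := t01 i.
  rewrite !mxE ger0_norm ?mulr_ge0// => Uw; exists i.
  rewrite -[s]opprK -s0' mulNr; apply: ratio_exceeds_ge => //.
  rewrite lt_def mulr_ge0// andbT; apply/negP => /eqP e0; move: Uw.
  by rewrite e0 mul0r ltNge ltW.
apply: le_trans (prob_lt_gmax_ge _).
rewrite lee_fin dnorm_homo// lerD2l lerN2 ler_pM2l//.
rewrite -[leRHS]mulr1 -t1 mulr_sumr; apply: ler_sum => i _.
have /andP[ti0 ti1] := t01 i.
rewrite mxE exprMn ler_wpM2l ?sqr_ge0// expr2 ler_piMr//.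
Qed.

(** Sums t_i <= N t over i: it makes the additive error K |s| ^ 2 relative. *)
Lemma dnorm_simplex_ge (t : 'rV[R]_d) : simplex t -> 1 <= d%:R * N t.
Proof.
move=> [t01 t1]; rewrite -[leLHS]t1 mulr_natl -[in leRHS](card_ord d) -sumr_const.
by apply: ler_sum => i _; apply: le_dnorm; have /andP[] := t01 i.
Qed.

Lemma copula_along_near (t : 'rV[R]_d) (s : R) : simplex t ->
  - (4 * K)^-1 <= s -> s < 0 ->
  `|(1 - along (copula_of V) t s) / (`|s| * N t) - 1| <= (4 + d%:R) * K * `|s|.
Proof.
move=> st sK s0.
have K0 : 0 < K by exact: lt_le_trans K1.
have dN := dnorm_simplex_ge st.
have N0 : 0 < N t.
  have := lt_le_trans ltr01 dN; rewrite pmulr_rgt0// ltr0n.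
  by case: (d) dN => //; rewrite mul0r ler10.
have sn : 0 < `|s| by rewrite normr_gt0 lt_eqF.
have up := copula_along_le st sK (ltW s0).
have lo := copula_along_ge st (ltW s0).
have d0 : 0 <= d%:R :> R by [].
have sN0 : 0 < `|s| * N t by rewrite mulr_gt0.
set q := (1 - _) in up lo *; set S := `|s| in up lo sn sN0 *.
rewrite ler_norml; apply/andP; split.
  rewrite lerBrDl ler_pdivlMr//; apply: le_trans lo.
  have : K * S ^+ 2 <= d%:R * N t * (K * S ^+ 2).
    by rewrite ler_peMl// mulr_ge0 ?sqr_ge0 ?ltW.
  have : 0 <= 4 * K * S * (S * N t) by rewrite !mulr_ge0// ltW.
  by lra.
rewrite lerBlDl ler_pdivrMr//; apply: (le_trans up).
have : 0 <= d%:R * K * S * (S * N t) by rewrite !mulr_ge0// ltW.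
lra.
Qed.

Hypothesis Z_cont : forall i, continuous (rdf (Z i)).

(** For x != 0 the event reads U = Z_i / x, null since U has no atom given Z;
    for x = 0 it reads Z_i = 0, null since Z_i has no atom. *)
Lemma ratio_noatom i x : P [set w | V i w = x] = 0%E.
Proof.
have mVx : measurable [set w | V i w = x] by exact: measurable_eq.
apply/eqP; rewrite -measure_le0.
have [->|x0] := eqVneq x 0.
  rewrite -(prob_eq_of_continuous 0 (@Z_cont i)).
  apply: (le_prob_on mU0) => //; [exact: measurable_eq..|].
  move=> w /= [+ u0]; rewrite /ratio => /eqP.
  by rewrite mulf_eq0 invr_eq0 gt_eqF//= => /eqP.
have mf : measurable_fun setT (fun z : d.-tuple R => x^-1 * tnth z i).
  by apply: measurable_funM => //; exact: measurable_tnth.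
rewrite -(independent_uniform_eq U_unif U_indep mf).
apply: (le_prob_on mU0) => //.
  apply: measurable_eq => //.
  by under eq_fun do rewrite tnth_mktuple; exact: measurable_funM.
move=> w [Vx u0]; rewrite /= tnth_mktuple.
have -> : Z i w = x * U w.
  by rewrite -[x]Vx /V /= /ratio mulrAC mulVf ?mul1r// gt_eqF.
by rewrite mulrA mulVf// mul1r.
Qed.

Lemma copula_of_is_copula : is_copula (copula_of V).
Proof.
exists disp, T, P, (fun i => RV_of (mF i)); split => // i.
apply: rdf_uniform; apply: rdf_continuous; exact: ratio_noatom.
Qed.

End Neighborhood.

(** * Existence of a generalized Pareto copula with given D-norm *)

Section Completion.
Context {d} {S : measurableType d} {R : realType}.

(** The mass missing on A is put at a point a outside A. *)
Lemma probability_completing (mu : {measure set S -> \bar R}) (A : set S) (a : S) :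
  measurable A -> (mu A <= 1)%E -> ~ A a ->
  exists Q : probability S R,
    forall B, measurable B -> B `<=` A -> Q B = mu B.
Proof.
move=> mA mu1 Aa.
have fin : mu A \is a fin_num.
  by rewrite ge0_fin_numE// (le_lt_trans mu1)// ltry.
have r0 : 0 <= 1 - fine (mu A).
  by rewrite subr_ge0 -lee_fin fineK.
pose m1 : {measure set S -> \bar R} := mrestr mu mA.
pose m2 : {measure set S -> \bar R} :=
  mscale (NngNum r0) (\d_a : {measure set S -> \bar R}).
pose q : {measure set S -> \bar R} := measure_add m1 m2.
have qE B : q B = (mu (B `&` A) + (1 - fine (mu A))%:E * \d_a B)%E.
  exact: measure_addE.
have q1 : q setT = 1%E.
  by rewrite qE setTI diracT mule1 -[X in (X + _)%E](fineK fin) -EFinD addrC subrK.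
exists (mnormalize q \d_a) => B mB BA.
rewrite /= /mnormalize q1 onee_eq0/= invr1 mule1 qE (setIidl BA).
by rewrite diracE memNset ?mule0 ?adde0// => /BA.
Qed.

End Completion.

Section ExistenceGPC.
Context {R : realType} {d : nat} {disp} {T : measurableType disp}.
Context {P : probability T R}.
Variables (Z : 'I_d -> {RV P >-> R}) (N : 'rV[R]_d -> R).
Hypotheses (N_norm : is_norm N) (Z_gen : generates Z N).

Local Notation L := (measurableTypeR R).
Local Notation leb := (@lebesgue_measure R).
Local Notation unif := (uniform_prob (@ltr01 R)).

Let measurable_toR : measurable_fun [set: L] (fun v : L => v : R).
Proof. by move=> _ B mB; rewrite setTI. Qed.

(** Fubini on the region under the graph of f; the two inclusions allow any
    convention on the boundary, a null set. *)
Lemma undergraph_measure (f : T -> R) (B : set (T * L)) :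
  (forall w, 0 <= f w) ->
  [set wr | 0 < wr.2 < f wr.1] `<=` B -> B `<=` [set wr | 0 < wr.2 <= f wr.1] ->
  measurable B -> (P \x leb)%E B = (\int[P]_w (f w)%:E)%E.
Proof.
move=> f0 fB Bf mB; apply: eq_integral => w _ /=.
have mBw : measurable (xsection B w) by exact: measurable_xsection.
apply/eqP; rewrite eq_le; apply/andP; split.
  apply: (@le_trans _ _ (leb `]0, f w])).
    rewrite le_measure ?inE// => r; rewrite /xsection /= inE => /Bf /=.
    by rewrite in_itv.
  rewrite lebesgue_measure_itv/= lte_fin oppr0 adde0; case: ifPn => // _.
  by rewrite lee_fin.
apply: (@le_trans _ _ (leb `]0, f w[)).
  rewrite lebesgue_measure_itv/= lte_fin oppr0 adde0; case: ifPn => //.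
  by rewrite -leNgt lee_fin.
rewrite le_measure ?inE// => r; rewrite /= in_itv/= => rf.
by rewrite /xsection /= inE; exact: fB.
Qed.

(* Any c with 0 < c and c d <= 1 works in what follows; d + 1 rather than d
   keeps c defined and positive in dimension 0. *)
Let c : R := d.+1%:R^-1.

Let c0 : 0 < c. Proof. by rewrite invr_gt0. Qed.

Let sub1c_ge0 : 0 <= 1 - c.
Proof. by rewrite subr_ge0 invf_le1// ler1n. Qed.

Lemma dnorm_const_le (a : R) : 0 <= a -> N (const_mx a) <= d%:R * a.
Proof.
move=> a0; have -> : const_mx a = \sum_(i < d) a *: delta_mx ord0 i :> 'rV[R]_d.
  apply/rowP => j; rewrite summxE (bigD1 j)//= big1 => [|i ij].
    by rewrite !mxE !eqxx mulr1 addr0.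
  by rewrite !mxE eqxx eq_sym (negbTE ij) mulr0.
rewrite mulr_natl -[in leRHS](card_ord d) -sumr_const.
elim/big_ind2 : _ => [|x y x' y' hx hx'|i _].
- by have := dnorm_homo N_norm 0 (lexx 0); rewrite scale0r mul0r => ->.
- case: N_norm => _ _ Ntri; apply: (le_trans (Ntri _ _)); exact: lerD.
- by rewrite (dnorm_homo N_norm)// (dnorm_delta Z_gen) mulr1.
Qed.

(* The points (w, r) where r / Z_i(w) <= c for at least one i. *)
Let A := [set wr : T * L | 0 < wr.2 <= gmax Z (const_mx c) wr.1].

Let mr : measurable_fun setT (fun wr : T * L => wr.2 : R).
Proof. exact: (measurableT_comp measurable_toR). Qed.

Let measurable_strip_le (f : T -> R) : measurable_fun setT f ->
  measurable [set wr : T * L | 0 < wr.2 <= f wr.1].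
Proof.
move=> mf.
rewrite (_ : [set wr | _] = [set wr : T * L | 0 < (wr.2 : R)] `&`
    [set wr : T * L | (wr.2 : R) <= f wr.1]).
  apply: measurableI; first exact: measurable_lt.
  by apply: measurable_le => //; exact: (measurableT_comp mf).
by apply/seteqP; split => wr /= => [/andP[]|[-> ->]].
Qed.

Let mA : measurable A.
Proof. by apply: measurable_strip_le; exact: measurable_gmax. Qed.

Let A_le1 : ((P \x leb) A <= 1)%E.
Proof.
rewrite (@undergraph_measure (gmax Z (const_mx c)))//.
- rewrite (gmaxE Z_gen) lee_fin.
  apply: (le_trans (dnorm_const_le (ltW c0))).
  by rewrite /c ler_pdivrMr// mul1r ler_nat.
- by move=> w; exact: gmax_ge0.
- by move=> wr /= /andP[r0 rf]; rewrite /A /= r0 ltW.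
Qed.

Lemma exists_gpc_base : exists Q : probability (T * L)%type R,
  forall B, measurable B -> B `<=` A -> Q B = (P \x leb)%E B.
Proof.
apply: (@probability_completing _ _ _ (P \x leb)%E A (point, -1) mA A_le1).
by rewrite /A /= ltr0N1.
Qed.

(** For P \x leb the function r / Z_i has Lebesgue measure as its image, and the
    event that r / Z_i < x_i for some i has mass N x.  The coordinate below is
    1 - r / Z_i where r / Z_i <= c, and elsewhere a uniform value v rescaled to
    the interval [0, 1 - c] that remains. *)
Definition gpc_coord (i : 'I_d) (o : (T * L) * L) : R :=
  if 0 < o.1.2 <= c * Z i o.1.1 then 1 - o.1.2 / Z i o.1.1 else (1 - c) * o.2.

Let mZr i : measurable_fun setT (fun wr : T * L => Z i wr.1).
Proof.
have mZ : measurable_fun setT (Z i) by [].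
exact: (measurableT_comp mZ).
Qed.

Let mS i : measurable [set wr : T * L | 0 < wr.2 <= c * Z i wr.1].
Proof.
have mcZ : measurable_fun setT (fun w => c * Z i w) by exact: measurable_funM.
exact: (measurable_strip_le mcZ).
Qed.

Lemma measurable_gpc_coord i : measurable_fun setT (gpc_coord i).
Proof.
have mr1 : measurable_fun setT (fun o : (T * L) * L => o.1.2 : R).
  exact: (measurableT_comp mr).
have mZ1 : measurable_fun setT (fun o : (T * L) * L => Z i o.1.1).
  exact: (measurableT_comp (mZr i)).
apply: measurable_fun_ifT.
- apply: (measurable_fun_bool true); rewrite setTI.
  rewrite (_ : _ @^-1` _ = fst @^-1` [set wr : T * L | 0 < wr.2 <= c * Z i wr.1])//.
  by rewrite -[_ @^-1` _]setTI; exact: measurable_fst.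
- apply: measurable_funB => //; apply: measurable_funM => //.
  by apply: measurableT_comp => //; exact: measurable_inv.
- exact: measurable_funM.
Qed.

Variable Q0 : probability (T * L)%type R.
Hypothesis Q0E : forall B, measurable B -> B `<=` A -> Q0 B = (P \x leb)%E B.

Let Q : probability ((T * L) * L)%type R := (Q0 \x unif)%E.

Let QX B C : measurable B -> measurable C -> Q (B `*` C) = (Q0 B * unif C)%E.
Proof. by move=> mB mC; rewrite -product_measure1E. Qed.

Let unif_lt1 : unif [set v | v <= 1] = 1%E.
Proof.
rewrite uniform01E; last first.
  by rewrite (_ : [set v | _] = `]-oo, 1]%classic)//; apply/seteqP; split => v /=;
    rewrite in_itv.
rewrite setIidr; first by rewrite lebesgue_measure_itv/= lte_fin ltr01 oppr0 adde0.
by move=> v /=; rewrite in_itv/= => /andP[].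
Qed.

Let c_le1 : c <= 1. Proof. by rewrite -subr_ge0. Qed.

Let le_gmax_const i w : c * Z i w <= gmax Z (const_mx c) w.
Proof.
rewrite /gmax; apply: (le_trans _ (le_bigmax _ _ i)).
by rewrite !mxE gtr0_norm.
Qed.

Let Q0_strip i b (B : set (T * L)) : 0 < b <= c -> measurable B ->
  [set wr | 0 < wr.2 < b * Z i wr.1] `<=` B ->
  B `<=` [set wr | 0 < wr.2 <= b * Z i wr.1] -> Q0 B = b%:E.
Proof.
move=> /andP[b0 bc] mB B1 B2.
have bE w : gmax Z (b *: delta_mx ord0 i) w = Num.max 0 (b * Z i w).
  by rewrite gmax_delta gtr0_norm.
have bcZ w : 0 < b * Z i w -> b * Z i w <= c * Z i w.
  by rewrite pmulr_rgt0// => Z0; rewrite ler_pM2r.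
rewrite Q0E//; last first.
  move=> wr /B2 /= /andP[r0 rb]; rewrite /A /= r0/= (le_trans rb)//.
  by rewrite (le_trans (bcZ _ _))// (lt_le_trans r0).
rewrite (@undergraph_measure (gmax Z (b *: delta_mx ord0 i)))//.
- by rewrite (gmaxE Z_gen) (dnorm_homo N_norm) ?(ltW b0)// (dnorm_delta Z_gen) mulr1.
- by move=> w; exact: gmax_ge0.
- move=> wr /= /andP[r0 rb]; apply: B1 => /=; rewrite r0/=.
  by move: rb; rewrite bE lt_max ltNge (ltW r0).
- by move=> wr /B2 /= /andP[r0 rb]; rewrite r0 bE le_max rb orbT.
Qed.

(** The part of {y < Y_i} with r / Z_i <= c has mass min(c, 1 - y); the rest
    has mass 1 - c times the uniform tail at y / (1 - c). *)
Lemma gpc_coord_tail i y : 0 <= y < 1 ->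
  Q [set o | y < gpc_coord i o] = (1 - y)%:E.
Proof.
move=> /andP[y0 y1].
pose S := [set wr : T * L | 0 < wr.2 <= c * Z i wr.1].
pose B := S `&` [set wr : T * L | (wr.2 : R) < (1 - y) * Z i wr.1].
have mSi : measurable S by exact: mS.
have mB : measurable B.
  by apply: measurableI => //; apply: measurable_lt => //; exact: measurable_funM.
have mSc : measurable (~` S) by exact: measurableC.
pose C := [set v : L | y < (1 - c) * (v : R)].
have mC : measurable C.
  by apply: measurable_lt => //; exact: measurable_funM.
have -> : [set o | y < gpc_coord i o] = (B `*` setT) `|` (~` S `*` C).
  apply/seteqP; split => -[[w r] v]; rewrite /gpc_coord /B /S /C /=.
    case: ifPn => [rc|rc] h; [left|right] => //.
    split => //; split => //; move: rc h => /andP[r0 rc].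
    have Z0 : 0 < Z i w.
      by have := lt_le_trans r0 rc; rewrite pmulr_rgt0.
    by rewrite ltrBrDr -ltrBrDl ltr_pdivrMr.
  move=> [[[rc rZ] _]|[rc h]]; last by rewrite ifF//; exact/negP.
  rewrite rc; move: rc => /andP[r0 rc].
  have Z0 : 0 < Z i w.
    by have := lt_le_trans r0 rc; rewrite pmulr_rgt0.
  by rewrite ltrBrDr -ltrBrDl ltr_pdivrMr.
transitivity (Q (B `*` setT) + Q (~` S `*` C))%E.
  apply: measureU; [exact: measurableX..|].
  by apply/seteqP; split => // -[[w r] v] /= [[[+ _] _] []].
rewrite !QX// probability_setT mule1 probability_setC//.
have SE : Q0 S = c%:E.
  apply: (@Q0_strip i) => //; first by rewrite c0 lexx.
  by move=> wr /= /andP[r0 rb]; rewrite /S /= r0 ltW.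
have BE : Q0 B = (Num.min c (1 - y))%:E.
  have b0 : 0 < Num.min c (1 - y) by rewrite lt_min c0 subr_gt0.
  apply: (@Q0_strip i) => //; first by rewrite b0 ge_min lexx.
    move=> wr /= /andP[r0 rb]; rewrite /B /S /=.
    have Z0 : 0 < Z i wr.1 by have := lt_trans r0 rb; rewrite pmulr_rgt0.
    rewrite r0 (le_trans (ltW rb)) ?(lt_le_trans rb)//.
      by rewrite ler_pM2r// ge_min lexx orbT.
    by rewrite ler_pM2r// ge_min lexx.
  move=> wr [/= /andP[r0 rb] rZ]; rewrite r0/=.
  by case: (leP c (1 - y)) => // _; exact: ltW.
have [c1|] := eqVneq c 1.
  rewrite SE BE c1 -EFinB subrr mul0e adde0 min_r//.
  by rewrite gerDl oppr_le0.
rewrite -subr_eq0 -oppr_eq0 opprB => c1N.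
have c1 : 0 < 1 - c by rewrite lt_def c1N.
have -> : C = `]y / (1 - c), +oo[%classic.
  by apply/seteqP; split => v; rewrite /C /= in_itv/= andbT ltr_pdivrMr// mulrC.
rewrite uniform01_gt ?divr_ge0// SE BE -EFinB -EFinM -EFinD; congr EFin.
have [yc|yc] := leP c (1 - y).
  have h : y / (1 - c) <= 1 by rewrite ler_pdivrMr// mul1r; lra.
  by rewrite (min_r h); field.
have h : 1 <= y / (1 - c) by rewrite ler_pdivlMr// mul1r; lra.
by rewrite (min_l h) subrr mulr0 addr0.
Qed.

Let Y i : {RV Q >-> R} := RV_of (measurable_gpc_coord i).

(** Since x_i < c, a rescaled value (1 - c) v with v <= 1 stays below 1 - x_i,
    so only the part governed by P \x leb contributes. *)
Lemma gpc_coord_exceed (x : 'rV[R]_d) : (forall i, 0 <= x ord0 i <= c / 2) ->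
  Q [set o | exists i, 1 - x ord0 i < gpc_coord i o] = (N x)%:E.
Proof.
move=> x0c.
have x0 i : 0 <= x ord0 i by have /andP[] := x0c i.
have xc2 i : x ord0 i <= c / 2 by have /andP[] := x0c i.
have xc i : x ord0 i < c.
  by rewrite (le_lt_trans (xc2 i))// ltr_pdivrMr// ltr_pMr// ltr1n.
pose B := [set wr : T * L | 0 < wr.2 < gmax Z x wr.1].
have mB : measurable B.
  rewrite (_ : B = [set wr : T * L | 0 < (wr.2 : R)] `&`
      [set wr : T * L | (wr.2 : R) < gmax Z x wr.1]).
    apply: measurableI; first exact: measurable_lt.
    apply: measurable_lt => //.
    by apply: (measurableT_comp (measurable_gmax Z x)).
  by apply/seteqP; split => wr /= => [/andP[]|[+ +]]; rewrite /B/= => -> ->.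
have QB : Q (B `*` setT) = (N x)%:E.
  rewrite QX// probability_setT mule1 Q0E//.
    rewrite (@undergraph_measure (gmax Z x))// ?(gmaxE Z_gen)//.
    - by move=> w; exact: gmax_ge0.
    - by move=> wr /= /andP[r0 rb]; rewrite r0 ltW.
  move=> wr /= /andP[r0 /(lt_gmaxP _ _ _ (ltW r0))[i]].
  rewrite ger0_norm// => ri; rewrite /A /= r0/= (le_trans _ (le_gmax_const i _))//.
  have Z0 : 0 < Z i wr.1.
    rewrite ltNge; apply/negP => Z0; have := lt_trans r0 ri.
    by rewrite ltNge mulr_ge0_le0.
  by rewrite (le_trans (ltW ri))// ler_pM2r// ltW.
have QG : Q (setT `*` [set v : L | (v : R) <= 1]) = 1%E.
  rewrite QX// ?probability_setT ?mul1e//.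
  exact: measurable_le.
have mG : measurable (setT `*` [set v : L | (v : R) <= 1] : set ((T * L) * L)).
  by apply: measurableX => //; exact: measurable_le.
rewrite -QB; apply/eqP; rewrite eq_le.
have mE : measurable [set o | exists i, 1 - x ord0 i < gpc_coord i o].
  apply: measurable_exists => i; apply: measurable_lt => //.
  exact: measurable_gpc_coord.
have mB' : measurable (B `*` [set: L]) by exact: measurableX.
apply/andP; split; apply: (le_prob_on mG) => // -[[w r] v] /=.
  move=> [[i]]; rewrite /gpc_coord /= => + [_ v1]; rewrite /B /=.
  case: ifPn => [/andP[r0 rc]|_] h.
    split => //; rewrite r0/=; apply/lt_gmaxP; first exact: ltW.
    exists i; rewrite ger0_norm//.
    have Z0 : 0 < Z i w by have := lt_le_trans r0 rc; rewrite pmulr_rgt0.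
    by move: h; rewrite ltrD2l ltrN2 ltr_pdivrMr.
  have := xc i; have : (1 - c) * v <= 1 - c by rewrite ler_piMr.
  by lra.
move=> [[+ _] _]; rewrite /B /= => /andP[r0 /(lt_gmaxP _ _ _ (ltW r0))[i]].
rewrite ger0_norm// => ri; exists i; rewrite /gpc_coord /= r0/=.
have Z0 : 0 < Z i w.
  rewrite ltNge; apply/negP => Z0; have := lt_trans r0 ri.
  by rewrite ltNge mulr_ge0_le0.
rewrite (le_trans (ltW ri)) ?ler_pM2r ?ltW//.
by rewrite ltrD2l ltrN2 ltr_pdivrMr.
Qed.

Lemma gpc_coord_gpc : is_dnorm N -> is_gpc N (joint_df Q (fun i => Y i)).
Proof.
move=> dN; split => //.
  exists _, _, Q, Y; split => // i; apply: is_uniform01_gt => y y01.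
  exact: gpc_coord_tail.
exists (const_mx (1 - c / 2)); split => [i|u u01].
  rewrite !mxE subr_gt0 ltr_pdivrMr// mul1r ltrBlDr ltrDl divr_gt0//.
  by rewrite (le_lt_trans c_le1)// ltr1n.
have x0c i : 0 <= (const_mx 1 - u) ord0 i <= c / 2.
  by have := u01 i; rewrite !mxE subr_ge0 lerBlDl -lerBlDr => /andP[-> ->].
have mE : measurable [set o | exists i, 1 - (const_mx 1 - u) ord0 i < gpc_coord i o].
  apply: measurable_exists => i; apply: measurable_lt => //.
  exact: measurable_gpc_coord.
rewrite /joint_df -[RHS]/(fine (1 - N (const_mx 1 - u))%:E) EFinB.
rewrite -(gpc_coord_exceed x0c) -(probability_setC Q mE); congr (fine (Q _)).
apply/seteqP; split => o /= h.
  by move=> [i]; have := h i; rewrite !mxE subKr leNgt => /negP.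
move=> i; rewrite leNgt; apply/negP => hi; apply: h; exists i.
by rewrite !mxE subKr.
Qed.

End ExistenceGPC.

Lemma exists_gpc (R : realType) (d : nat) (N : 'rV[R]_d -> R) :
  is_dnorm N -> exists C : 'rV[R]_d -> R, is_gpc N C.
Proof.
move=> dN; have [N_norm [disp [T [P [Z Z_gen]]]]] := dN.
have [Q0 Q0E] := exists_gpc_base N_norm Z_gen.
eexists; exact: (gpc_coord_gpc N_norm Z_gen Q0E dN).
Qed.

(** * The neighborhood theorem *)

Unset Implicit Arguments.
Set Strict Implicit.

Theorem theorem6p2 (R : realType) (d : nat) (d_gt0 : (0 < d)%N)
    (disp : measure_display) (T : measurableType disp) (P : probability T R)
    (Z : 'I_d -> {RV P >-> R}) (U : {RV P >-> R}) (N : 'rV[R]_d -> R)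
    (N_dnorm : is_dnorm N)
    (Z_gen : generates Z N)
    (U_unif : is_uniform01 U)
    (U_indep : independent_of_vector U Z)
    (Z_sq : forall i, ('E_P[(fun w => Z i w ^+ 2)%R] < +oo)%E)
    (Z_cont : forall i, continuous (rdf (Z i))) :
  let V := fun i => ratioRV (Z i) U in
  (exists CD : 'rV[R]_d -> R, is_gpc N CD) /\
  (forall CD : 'rV[R]_d -> R, is_gpc N CD ->
     in_delta_neighborhood 1 (copula_of V) CD N).
Proof.
move=> V; split=> [|CD CD_gpc]; first exact: exists_gpc.
have N_norm : is_norm N by case: N_dnorm.
have Z2_ge0 i : (0 <= \int[P]_w (Z i w ^+ 2)%:E)%E.
  by apply: integral_ge0 => w _; rewrite lee_fin sqr_ge0.
(* The leading 1 gives 1 <= K, hence 0 < K, even when the sum vanishes. *)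
pose K : R := 1 + \sum_i fine (\int[P]_w (Z i w ^+ 2)%:E)%E.
have S0 (i : 'I_d) : 0 <= fine (\int[P]_w (Z i w ^+ 2)%:E)%E by exact: fine_ge0.
have K1 : 1 <= K by rewrite /K lerDl sumr_ge0.
have K0 : 0 < K by exact: lt_le_trans K1.
have ZK i : (\int[P]_w (Z i w ^+ 2)%:E <= K%:E)%E.
  rewrite -[leLHS]fineK ?lee_fin.
    rewrite /K (bigD1 i)//= addrCA lerDl addr_ge0// sumr_ge0//.
  by rewrite ge0_fin_numE//; have := Z_sq i; rewrite unlock.
split=> //.
  exact: (copula_of_is_copula U_unif U_indep Z_cont).
exists ((4 + d%:R) * K), (- (4 * K)^-1); split.
- by rewrite mulr_gt0// ltr_pwDl.
- by rewrite oppr_lt0 invr_gt0 mulr_gt0.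
move=> s t /andP[sK s0] t_simplex; rewrite powRr1//.
exact: (copula_along_near N_norm Z_gen U_unif U_indep K1 ZK t_simplex sK s0).
Qed.
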